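(* Let $C\subset\mathbb{R}^n$ be a closed cone, let $K\subset C$ be nonempty, closed, unbounded and convex, let $U\subset\mathbb{R}^n$ be an open set containing $K$, and let $f:C\cup U\to\mathbb{R}$ be continuous on $C$, weakly homogeneous of degree $\alpha>1$ relative to $K$, differentiable on $U$, convex on $K$, and bounded from below on $K$. For $u\in\mathbb{R}^n$ put $f_u(x):=f(x)+\langle u,x\rangle$, and let $\mathcal{D}(K,f):=(K^{\infty})^*-\nabla f(K)$. If $\operatorname{int}(\mathcal{D}(K,f))\neq\emptyset$ and $u\in\operatorname{int}(\mathcal{D}(K,f))$, then $\operatorname{Sol}(K,f_u)$ is nonempty and bounded.
   Context: A cone is a nonempty set closed under multiplication by positive scalars. For a nonempty closed set $S\subset\mathbb{R}^n$, the asymptotic cone is $S^{\infty}=\{v\in\mathbb{R}^n:\exists t_k\to+\infty,\ \exists x^k\in S,\ \lim_{k\to\infty} x^k/t_k=v\}$. The dual cone of a cone $D$ is $D^*=\{u\in\mathbb{R}^n:\langle u,v\rangle\ge 0\ \forall v\in D\}$; $\operatorname{int}$ denotes topological interior. $\nabla f(K)=\{\nabla f(x):x\in K\}$, and $A-B=\{a-b:a\in A,\ b\in B\}$ for sets $A,B\subset\mathbb{R}^n$. $f$ is weakly homogeneous of degree $\alpha>0$ relative to $K$ if there is a continuous function $h:C\to\mathbb{R}$, positively homogeneous of degree $\alpha$ (that is, $h(tx)=t^{\alpha}h(x)$ for all $x\in C$, $t>0$), such that $f(x)-h(x)=o(\|x\|^{\alpha})$ on $K$ (i.e. $(f(x)-h(x))/\|x\|^{\alpha}\to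 0$ as $\|x\|\to\infty$ with $x\in K$). For a nonempty closed set $S$ and a continuous function $g$ on $S$, $\operatorname{Sol}(S,g)$ is the set of global minimizers of $g$ over $S$. *)

(* Defs.v *)
From HB Require Import structures.
From mathcomp Require Import all_boot all_order all_algebra.
From mathcomp Require Import all_classical all_reals all_analysis.

Set Implicit Arguments.
Unset Strict Implicit.
Unset Printing Implicit Defensive.

Import Order.TTheory GRing.Theory Num.Theory.
Import numFieldNormedType.Exports.

Local Open Scope classical_set_scope.
Local Open Scope ring_scope.

(* R^n is 'rV[R]_n.  Its library topology comes from the max norm; the inner
   product and the Euclidean norm are therefore given explicitly.  A function
   with domain A is a total function, constrained only by its values on A. *)

Definition dotp (R : realType) (n : nat) (u v : 'rV[R]_n) : R :=
  \sum_(i < n) u 0 i * v 0 i.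

Definition enorm (R : realType) (n : nat) (x : 'rV[R]_n) : R :=
  Num.sqrt (dotp x x).

Definition is_cone (R : realType) (n : nat) (C : set 'rV[R]_n) : Prop :=
  C !=set0 /\ (forall (t : R) (x : 'rV[R]_n), 0 < t -> C x -> C (t *: x)).

(* Only the tail of t matters to the limits, so the convention 0^-1 = 0 is
   harmless here. *)
Definition asymptotic_cone (R : realType) (n : nat) (S : set 'rV[R]_n) :
    set 'rV[R]_n :=
  [set v | exists (t : nat -> R) (x : nat -> 'rV[R]_n),
    [/\ t k @[k --> \oo] --> +oo,
        forall k, S (x k)
      & (t k)^-1 *: x k @[k --> \oo] --> v] ].

Definition dual_cone (R : realType) (n : nat) (D : set 'rV[R]_n) :
    set 'rV[R]_n :=
  [set u | forall v, D v -> 0 <= dotp u v].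

Definition grad (R : realType) (n : nat) (f : 'rV[R]_n -> R) (x : 'rV[R]_n) :
    'rV[R]_n :=
  \row_(i < n) 'D_(delta_mx 0 i) f x.

Definition pos_homogeneous (R : realType) (n : nat) (C : set 'rV[R]_n)
    (alpha : R) (h : 'rV[R]_n -> R) : Prop :=
  forall (x : 'rV[R]_n) (t : R), C x -> 0 < t -> h (t *: x) = t `^ alpha * h x.

(* The last clause says (f x - h x) / ||x|| ^ alpha --> 0 as ||x|| --> +oo
   with x in K. *)
Definition weakly_homogeneous (R : realType) (n : nat) (C K : set 'rV[R]_n)
    (alpha : R) (f : 'rV[R]_n -> R) : Prop :=
  exists h : 'rV[R]_n -> R,
    [/\ {within C, continuous h},
        pos_homogeneous C alpha h
      & forall e : R, 0 < e -> exists M : R, forall x : 'rV[R]_n,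
          K x -> M < enorm x -> `|(f x - h x) / enorm x `^ alpha| < e].

Definition Sol (R : realType) (n : nat) (S : set 'rV[R]_n)
    (g : 'rV[R]_n -> R) : set 'rV[R]_n :=
  [set x | S x /\ forall y, S y -> g x <= g y].

Definition perturb (R : realType) (n : nat) (f : 'rV[R]_n -> R)
    (u x : 'rV[R]_n) : R :=
  f x + dotp u x.

Definition Dset (R : realType) (n : nat) (K : set 'rV[R]_n)
    (f : 'rV[R]_n -> R) : set 'rV[R]_n :=
  [set a - b | a in dual_cone (asymptotic_cone K) & b in grad f @` K].

(* Main.v *)
(** Every sublevel set of [f_u] in [K] is bounded.  Otherwise the normalised
    points [z / |z|] of a sublevel set accumulate at some nonzero [v] in the
    asymptotic cone of [K]; dividing the tangent inequality
    [f_u x + <grad f x + u, z - x> <= f_u z] by [|z|] yields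
    [<grad f x + u, v> <= 0] for every [x] in [K].  But [u - e v] lies in
    [(K^oo)^* - grad f (K)] for small [e > 0], that is
    [grad f x + u = a + e v] for some [x] in [K] and [a] in the dual cone,
    whence [<grad f x + u, v> >= e <v, v> > 0].  A minimiser then exists on a
    large compact piece of [K]. *)

Require Import Defs.
From HB Require Import structures.
From mathcomp Require Import all_boot all_order all_algebra.
From mathcomp Require Import all_classical all_reals all_analysis.
From mathcomp Require Import lra.

Import Order.TTheory GRing.Theory Num.Theory.
Import numFieldNormedType.Exports.

Local Open Scope classical_set_scope.
Local Open Scope ring_scope.

Set Implicit Arguments.
Unset Strict Implicit.

Lemma dotpDl (R : realType) (n : nat) (u v w : 'rV[R]_n) :
  dotp (u + v) w = dotp u w + dotp v w.
Proof.
by rewrite -big_split; apply: eq_bigr => i _; rewrite mxE mulrDl.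
Qed.

Lemma dotpZl (R : realType) (n : nat) (c : R) (u w : 'rV[R]_n) :
  dotp (c *: u) w = c * dotp u w.
Proof.
by rewrite /dotp mulr_sumr; apply: eq_bigr => i _; rewrite mxE mulrA.
Qed.

Lemma dotpC (R : realType) (n : nat) (u v : 'rV[R]_n) : dotp u v = dotp v u.
Proof. by apply: eq_bigr => i _; rewrite mulrC. Qed.

Lemma dotpDr (R : realType) (n : nat) (u v w : 'rV[R]_n) :
  dotp u (v + w) = dotp u v + dotp u w.
Proof. by rewrite dotpC dotpDl !(dotpC u). Qed.

Lemma dotpZr (R : realType) (n : nat) (c : R) (u w : 'rV[R]_n) :
  dotp u (c *: w) = c * dotp u w.
Proof. by rewrite dotpC dotpZl dotpC. Qed.

Lemma dotp_gt0 (R : realType) (n : nat) (v : 'rV[R]_n) :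
  v != 0 -> 0 < dotp v v.
Proof.
move=> v0; rewrite lt_def sumr_ge0 => [|i _]; last by rewrite -expr2 sqr_ge0.
rewrite andbT; apply: contra_neq v0 => /eqP vv0; apply/rowP => i; rewrite mxE.
move: vv0; rewrite psumr_eq0 => [/allP/(_ i)|j _]; last first.
  by rewrite -expr2 sqr_ge0.
by rewrite mem_index_enum mulf_eq0 orbb => /(_ isT)/eqP.
Qed.

Lemma cvg_dotp (R : realType) (n : nat) (w v : 'rV[R]_n) (T : Type)
    (F : set_system T) (FF : Filter F) (g : T -> 'rV[R]_n) :
  g x @[x --> F] --> v -> dotp w (g x) @[x --> F] --> dotp w v.
Proof.
move=> gv; rewrite /dotp; elim: (index_enum _) => [|i s IHs].
  rewrite (_ : (fun _ => _) = cst 0); first by rewrite big_nil; exact: cvg_cst.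
  by apply/funext => y; rewrite big_nil.
under eq_fun do rewrite big_cons; rewrite big_cons.
apply: cvgD IHs; apply: cvgM; first exact: cvg_cst.
apply: (@cvg_comp _ _ _ g (fun M : 'rV[R]_n => M 0 i) _ _ _ gv).
exact: coord_continuous.
Qed.

(** Differentiability makes the derivative linear in its direction, so expanding [v] in the basis
    vectors leaves the partial derivatives, which are the entries of [grad f x]. *)
Lemma derive_grad (R : realType) (n : nat) (f : 'rV[R]_n -> R)
    (x v : 'rV[R]_n) :
  differentiable f x -> 'D_v f x = dotp (grad f x) v.
Proof.
move=> df; rewrite deriveE // [in LHS](row_sum_delta v) linear_sum.
by apply: eq_bigr => i _; rewrite linearZ mxE deriveE // mulrC.
Qed.

(** By convexity, the difference quotient of [f] at [x] along [z - x] with step [h] in ]0, 1] is at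
    most [f z - f x]; the bound survives the limit as [h] decreases to 0. *)
Lemma convex_ge_tangent (R : realType) (n : nat) (K : set 'rV[R]_n)
    (f : 'rV[R]_n -> R) (x z : 'rV[R]_n) :
  @convex_function R 'rV[R]_n K f -> K x -> K z -> differentiable f x ->
  f x + dotp (grad f x) (z - x) <= f z.
Proof.
move=> fconv Kx Kz df; rewrite -lerBrDl -derive_grad //.
have dxz : derivable f x (z - x) := diff_derivable df.
have Dr : h^-1 *: (f (h *: (z - x) + x) - f x) @[h --> (0:R)^'+] -->
    'D_(z - x) f x.
  exact: cvg_dnbhs_at_right dxz.
rewrite -(cvg_lim _ Dr) //; apply: limr_le; first exact: cvgP Dr.
near=> h.
have h0 : 0 < h by [].
have h1 : h <= 1 by near: h; exact: nbhs_right_le.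
have /= := fconv (Itv01 (ltW h0) h1) z x.
rewrite !inE => /(_ Kz Kx).
rewrite convRE /conv /= /unstable.onem => fh.
rewrite [_ *: _]mulrC ler_pdivrMr //.
have -> : h *: (z - x) + x = h *: z + (1 - h) *: x.
  by rewrite scalerBr scalerBl scale1r -addrA [- _ + x]addrC addrA.
rewrite lerBlDr (le_trans fh) //.
by rewrite mulrBl mul1r mulrBl [h * f z]mulrC [h * f x]mulrC addrA addrAC.
Unshelve. all: by end_near. Qed.

(** Points of [S] escaping to infinity, scaled to norm 1, cluster on the compact unit sphere, and a
    vector of norm 1 is nonzero. *)
Lemma asymptotic_cone_nonzero (R : realType) (n : nat) (S : set 'rV[R]_n) :
  ~ bounded_set S -> exists2 v, v != 0 & asymptotic_cone S v.
Proof.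
move=> Sunb.
have far (M : R) : exists x, S x /\ M < `|x|.
  apply: contrapT => nx; apply: Sunb; exists M; split; first exact: num_real.
  move=> N MN x Sx /=; apply: ltW; apply: le_lt_trans MN.
  by rewrite leNgt; apply/negP => Mx; apply: nx; exists x.
have [y yP] := choice (fun k : nat => far k%:R).
have y0 k : `|y k| != 0.
  by rewrite gt_eqF // (le_lt_trans _ (yP k).2).
pose sphere := [set z : 'rV[R]_n | `|z| = 1].
have csphere : compact sphere.
  apply: bounded_closed_compact.
    by exists 1; split; [exact: num_real|move=> N N1 z /= ->; exact: ltW].
  apply: (@closed_comp _ _ (fun z : 'rV[R]_n => `|z|) [set 1]).
    by move=> z _; exact: norm_continuous.
  exact: closed_eq.
have /csphere : ((fun k => `|y k|^-1 *: y k) @ \oo) sphere.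
  by exists 0%N => // k _; rewrite /sphere/= normrZ normfV normr_id mulVf.
move=> [v [v1 vcl]].
(* A cluster point only gives points arbitrarily close to [v] arbitrarily late. Selecting one for
   each [k], with norm above [k], produces a convergent sequence whose scaling factors [|x k|] tend
   to infinity. *)
have near_v (k : nat) :
    exists x, [/\ S x, k%:R < `|x| & `|v - `|x|^-1 *: x| < k.+1%:R^-1].
  have tail : ((fun j => `|y j|^-1 *: y j) @ \oo)
      [set `|y j|^-1 *: y j | j in [set j | (k <= j)%N]].
    by exists k => // j kj; exists j.
  have vball : nbhs v (ball v k.+1%:R^-1).
    by apply: nbhsx_ballx; rewrite invr_gt0.
  have [z [/= [j kj <-] zb]] := vcl _ _ tail vball.
  exists (y j); split; first exact: (yP j).1.
    by apply: le_lt_trans (yP j).2; rewrite ler_nat.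
  by move: zb; rewrite -ball_normE.
have [x xP] := choice near_v.
exists v; first by rewrite -normr_eq0 v1 oner_eq0.
exists (fun k => `|x k|), x; split.
- apply: (@ger_cvgy _ _ _ _ (fun k => k%:R)); last exact: cvgr_idn.
  by apply: nearW => k; have [_ /ltW] := xP k.
- by move=> k; have [] := xP k.
- apply/cvgrPdist_lt => e e0.
  near=> k; have [_ _ /lt_trans] := xP k; apply.
  by near: k; exact: near_infty_natSinv_lt (PosNum e0).
Unshelve. all: by end_near. Qed.

Lemma Dset_grad_gt0 (R : realType) (n : nat) (K : set 'rV[R]_n)
    (f : 'rV[R]_n -> R) (u v : 'rV[R]_n) :
  (Dset K f)° u -> asymptotic_cone K v -> v != 0 ->
  exists2 x, K x & 0 < dotp (grad f x + u) v.
Proof.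
move=> uint Kv v0.
(* As [e] decreases to 0, [u - e *: v] tends to [u], so it eventually enters the neighbourhood
   [Dset K f] of [u]. *)
have : \forall e \near (0:R)^'+, Dset K f (u - e *: v).
  apply: cvg_at_right_filter uint.
  rewrite -[X in _ --> X]subr0 -(scale0r v).
  by apply: cvgB; [exact: cvg_cst|apply: cvgZ; [exact: cvg_id|exact: cvg_cst]].
move=> Dnear.
have [e [e0 [a aK [b [x Kx <-] /eqP]]]] :
    exists e : R, 0 < e /\ Dset K f (u - e *: v).
  near ((0:R)^'+) => e; exists e; split => //.
  by near: e.
rewrite subr_eq addrAC => /eqP ax.
exists x => //.
have -> : grad f x + u = a + e *: v by rewrite ax addrNK [RHS]addrC.
by rewrite dotpDl dotpZl ltr_wpDl ?aK // mulr_gt0 ?dotp_gt0.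
Unshelve. all: by end_near. Qed.

Lemma sublevel_perturb_bounded (R : realType) (n : nat) (K : set 'rV[R]_n)
    (f : 'rV[R]_n -> R) (u : 'rV[R]_n) (c : R) :
  @convex_function R 'rV[R]_n K f -> (forall x, K x -> differentiable f x) ->
  (Dset K f)° u -> bounded_set [set x | K x /\ perturb f u x <= c].
Proof.
move=> fconv df uint; apply: contrapT => /asymptotic_cone_nonzero.
move=> [v v0 [t [z [ty zS zv]]]].
have Kv : asymptotic_cone K v.
  by exists t, z; split=> // k; exact: (zS k).1.
have [x Kx] := Dset_grad_gt0 uint Kv v0; set w := _ + u; apply/negP.
(* With [w = grad f x + u], [B] collects the terms free of [z] when the tangent inequality at [x] is
   combined with [perturb f u z <= c]. *)
rewrite -leNgt; set B := c - f x - dotp u x + dotp w x.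
have zB k : dotp w (z k) <= B.
  have [Kz zc] := zS k.
  have := convex_ge_tangent fconv Kx Kz (df _ Kx).
  rewrite /B /w !dotpDl -scaleN1r dotpDr dotpZr.
  move: zc; rewrite /perturb; lra.
(* Dividing [zB] by [t k], which is eventually positive, and passing to the limit gives
   [dotp w v <= 0]. *)
have lhs : dotp w ((t k)^-1 *: z k) @[k --> \oo] --> dotp w v.
  exact: cvg_dotp zv.
have rhs : (t k)^-1 * B @[k --> \oo] --> 0.
  rewrite -(mul0r B); apply: cvgM; last exact: cvg_cst.
  by apply/gtr0_cvgV0 => //; exact: cvgry_gt.
rewrite -(cvg_lim _ lhs) // -(cvg_lim _ rhs) //.
apply: ler_lim; [exact: cvgP lhs|exact: cvgP rhs|].
near=> k; rewrite dotpZr ler_wpM2l // invr_ge0.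
by near: k; exact: cvgry_ge.
Unshelve. all: by end_near. Qed.

Unset Implicit Arguments.

Theorem theorem5p2 (R : realType) (n : nat) (C K U : set 'rV[R]_n)
  (f : 'rV[R]_n -> R) (alpha : R) (u : 'rV[R]_n)
  (C_closed : closed C) (C_cone : is_cone C)
  (K_sub_C : K `<=` C) (K_nonempty : K !=set0) (K_closed : closed K)
  (K_unbounded : ~ bounded_set K) (K_convex : @convex_set R 'rV[R]_n K)
  (U_open : open U) (K_sub_U : K `<=` U)
  (f_cont : {within C, continuous f})
  (alpha_gt1 : 1 < alpha) (f_wh : weakly_homogeneous C K alpha f)
  (f_diff : forall x, U x -> differentiable f x)
  (f_convex : @convex_function R 'rV[R]_n K f)
  (f_lbound : has_lbound (f @` K))
  (int_nonempty : (Dset K f)° !=set0)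
  (u_int : (Dset K f)° u) :
  Sol K (perturb f u) !=set0 /\ bounded_set (Sol K (perturb f u)).
Proof.
have df x : K x -> differentiable f x by move/K_sub_U; exact: f_diff.
have [x0 Kx0] := K_nonempty.
(* The level attained at [x0] keeps [L] nonempty, and every minimiser lies in [L]. *)
pose L := [set x | K x /\ perturb f u x <= perturb f u x0].
have Lb : bounded_set L by exact: sublevel_perturb_bounded.
split; last first.
  apply: (sub_boundedr _ Lb) => B LB x [Kx xmin].
  by apply: LB; split=> //; exact: xmin.
have [M M0 LM] : exists2 M, 0 < M & forall x, L x -> `|x| <= M.
  have [M M0 LM] := ex_strict_bound_gt0 Lb.
  by exists M => // x Lx; exact/ltW/LM.
pose A := K `&` [set x | `|x| <= M].
have A0 : A !=set0 by exists x0; split=> //; exact: LM.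
have Acompact : compact A.
  apply: bounded_closed_compact.
    exists M; split; first exact: num_real.
    by move=> N MN x [_ /le_trans]; apply; exact: ltW.
  apply: closedI => //.
  apply: (@closed_comp _ _ (fun z : 'rV[R]_n => `|z|) [set r | r <= M]).
    by move=> z _; exact: norm_continuous.
  exact: closed_le.
have Acont : {within A, continuous (perturb f u)}.
  apply: continuous_in_subspaceT => x; rewrite inE => -[Kx _].
  apply: continuousD; last exact: (@cvg_dotp _ _ u x _ (nbhs x) _ id).
  exact: differentiable_continuous (df _ Kx).
have [x] := EVT_min_rV A0 Acompact Acont; rewrite inE => -[Kx _] xmin.
exists x; split=> // y Ky.
(* The minimum over [A] is global: either [y] lies in [L], hence in [A], or its value exceeds that
   at [x0], itself a point of [A]. *)
have [yx0|/ltW] := leP (perturb f u y) (perturb f u x0).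
  by apply: xmin; rewrite inE; split=> //; exact: LM.
by apply: le_trans; apply: xmin; rewrite inE; split=> //; exact: LM.
Qed.
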